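(* Let $\alpha \in [1/3, 2/5)$ be directed triangle sufficient and let $\varepsilon > 0$. Then there exists $k_0$ such that for all integers $k \ge k_0$, \[ r_k(\mathcal{L}) < \frac{1+\varepsilon}{1-\alpha}\, k. \]
   Context: A constant $\alpha \in [1/3, 2/5)$ is called directed triangle sufficient if every oriented graph $D$ (a digraph with no loops and at most one arc between any two vertices) with minimum in-degree at least $\alpha |V(D)|$ contains a directed cycle of length 3. The loose path $\mathcal{L}$ is the 3-uniform hypergraph $\{abc, cde, efg\}$ on seven distinct vertices. For a 3-uniform hypergraph $\mathcal{H}$, $r_k(\mathcal{H})$ is the smallest integer $n$ such that every coloring of $\binom{[n]}{3}$ with $k$ colors contains a monochromatic copy of $\mathcal{H}$. *)

(* Defs.v *)
From mathcomp Require Import all_boot all_order all_algebra.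
From mathcomp Require Import reals.

Set Implicit Arguments.
Unset Strict Implicit.
Unset Printing Implicit Defensive.

Import Order.TTheory GRing.Theory Num.Theory.
Local Open Scope ring_scope.

(* The pair (V, arc) is a finite digraph; [arc x y] is the arc from x to y. *)
Definition oriented_graph (V : finType) (arc : rel V) : Prop :=
  irreflexive arc /\ (forall x y, arc x y -> ~~ arc y x).

Definition indegree (V : finType) (arc : rel V) (x : V) : nat :=
  #|[set y | arc y x]|.

(* In an oriented graph x, y, z are automatically distinct. *)
Definition has_directed_triangle (V : finType) (arc : rel V) : Prop :=
  exists x y z, [/\ arc x y, arc y z & arc z x].

(* Graphs are nonempty: the condition on the minimum in-degree would hold
   vacuously for the graph without vertices, and no alpha would qualify. *)
Definition directed_triangle_sufficient (R : realType) (alpha : R) : Prop :=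
  forall (V : finType) (arc : rel V),
    (0 < #|V|)%N -> oriented_graph arc ->
    (forall x, alpha * #|V|%:R <= (indegree arc x)%:R) ->
    has_directed_triangle arc.

Record hypergraph3 := Hypergraph3 {
  vertex : finType;
  edges : {set {set vertex}};
  edges_card : forall A, A \in edges -> #|A| = 3%N
}.

Definition loose_path_edges : {set {set 'I_7}} :=
  let a := @Ordinal 7 0%N isT in let b := @Ordinal 7 1%N isT in
  let c := @Ordinal 7 2%N isT in let d := @Ordinal 7 3%N isT in
  let e := @Ordinal 7 4%N isT in let f := @Ordinal 7 5%N isT in
  let g := @Ordinal 7 6%N isT in
  [set [set a; b; c]; [set c; d; e]; [set e; f; g]].

Lemma loose_path_edges_card A : A \in loose_path_edges -> #|A| = 3%N.
Proof. by rewrite !inE => /orP[/orP[]|] /eqP->; rewrite -setUA cardsU1 cards2 !inE. Qed.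

Definition loose_path : hypergraph3 := Hypergraph3 loose_path_edges_card.

Definition triple (n : nat) := {A : {set 'I_n} | #|A| == 3%N}.

(* The copy is the image of H under f, an injection of its vertices. *)
Definition has_mono_copy (H : hypergraph3) (n k : nat)
    (col : triple n -> 'I_k) : Prop :=
  exists (f : vertex H -> 'I_n) (i : 'I_k),
    injective f /\
    (forall t : triple n, val t \in [set f @: A | A : {set vertex H} in edges H] ->
       col t = i).

Definition ramsey_arrow (H : hypergraph3) (k n : nat) : Prop :=
  forall col : triple n -> 'I_k, has_mono_copy H col.

(* "r_k(H) = n" *)
Definition is_ramsey_number (H : hypergraph3) (k n : nat) : Prop :=
  ramsey_arrow H k n /\ (forall m, ramsey_arrow H k m -> (n <= m)%N).

(* Main.v *)
(* For a colour, call a pair of vertices heavy if its codegree in that colour is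
   at least 7. Heavy pairs contain no path with three edges, so they form stars
   and triangles; orient each heavy pair away from [x] towards [y] when [x] is
   the only heavy neighbour of [y]. All but O(n) edges of a loose-path-free
   colour class are good: either one vertex dominates the two others and these
   have codegree 1, or two vertices dominate each other and the other two pairs
   have codegree 1.

   Let D be the union of these digraphs over the k colours. Every in-degree in D
   is at most k, since a colour contributes at most one arc into each vertex. A
   pair unrelated in D lies in at most one good edge per colour, hence in at
   least n - 2 - k bad ones, so only O(n) pairs are unrelated. Dropping the
   2-cycles of D thus leaves an oriented graph in which out-degrees are about
   n - k, which exceeds (alpha + gamma) n, and whose directed triangles are all
   bad triples. There are only O(n^2) bad triples, so a random sample of bounded
   size avoids them all while keeping the degree condition, which contradicts
   the sufficiency of alpha for the reversed sample. *)
Require Import Defs.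
From mathcomp Require Import all_boot all_order all_algebra.
From mathcomp Require Import boolp reals.
From mathcomp Require Import zify ring lra.

Set Implicit Arguments.
Unset Strict Implicit.
Unset Printing Implicit Defensive.

(** * Loose-path-free colour classes *)

Section Codegree.
Variables (V : finType) (h : V -> V -> V -> bool).

Definition codegree (x y : V) : nat := #|[set z | h x y z]|.

(* Seven common neighbours suffice to pick one outside the other vertices of
   a loose path. *)
Definition heavy_pair (x y : V) : bool := 6 < codegree x y.

Definition heavy_arc (x y : V) : bool :=
  heavy_pair x y && [forall w, heavy_pair w y ==> (w == x)].

(* Besides edges of a large star centred at [x], the loose-path-free graphs with
   quadratically many edges include those made of all edges [{x, y, z}] with
   [x] in a fixed set and [{y, z}] in a family of disjoint pairs. *)
Definition good_around (x y z : V) : bool :=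
  [&& heavy_arc x y, heavy_arc x z & codegree y z <= 1] ||
  [&& heavy_arc y z, heavy_arc z y, codegree x y <= 1 & codegree x z <= 1].

Definition good_triple (x y z : V) : bool :=
  [|| good_around x y z, good_around y z x | good_around z x y].

Definition bad_triple (x y z : V) : bool := h x y z && ~~ good_triple x y z.

End Codegree.

Definition loose_path_free (V : finType) (h : V -> V -> V -> bool) :=
  forall a b c d e f g,
    h a b c -> h c d e -> h e f g -> uniq [:: a; b; c; d; e; f; g] -> False.

Section LoosePathFree.
Variables (V : finType) (h : V -> V -> V -> bool).
Hypothesis h12 : forall x y z, h x y z = h y x z.
Hypothesis h23 : forall x y z, h x y z = h x z y.
Hypothesis h_neq12 : forall x y z, h x y z -> x != y.
Hypothesis h_free : loose_path_free h.

Local Notation codeg := (codegree h).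
Local Notation heavy := (heavy_pair h).
Local Notation arc := (heavy_arc h).
Local Notation bad := (bad_triple h).

(** * Symmetries and fresh common neighbours *)

Lemma h_neq x y z : h x y z -> [/\ x != y, x != z & y != z].
Proof.
move=> hxyz; split; first exact: h_neq12 hxyz.
  by apply: (@h_neq12 _ _ y); rewrite h23.
by apply: (@h_neq12 _ _ x); rewrite h23 h12.
Qed.

Lemma codegC x y : codeg x y = codeg y x.
Proof. by congr #|pred_of_set _|; apply/setP => z; rewrite !inE h12. Qed.

Lemma heavyC x y : heavy x y = heavy y x.
Proof. by rewrite /heavy_pair codegC. Qed.

Lemma heavy_ext (S : seq V) (x y : V) :
  heavy x y -> size S <= 6 -> exists2 z, h x y z & z \notin S.
Proof.
move=> hxy szS; have /subsetPn[z] : ~~ ([set z | h x y z] \subset S).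
  apply/negP => /subset_leq_card le1.
  by move: (leq_trans hxy (leq_trans le1 (leq_trans (card_size S) szS))); rewrite ltnn.
by rewrite inE => hz zS; exists z.
Qed.

Lemma heavy_neq x y : heavy x y -> x != y.
Proof. by move=> /(@heavy_ext [::])[] // z /h_neq[]. Qed.

Lemma good_aroundC x y z : good_around h x y z = good_around h x z y.
Proof.
rewrite /good_around (codegC z y) andbCA; congr orb.
by rewrite andbCA [(codeg x y <= 1) && _]andbC.
Qed.

Lemma goodC12 x y z : good_triple h x y z = good_triple h y x z.
Proof.
rewrite /good_triple (good_aroundC y x) (good_aroundC x z) (good_aroundC z y).
by rewrite orbCA.
Qed.

Lemma goodC23 x y z : good_triple h x y z = good_triple h x z y.
Proof.
rewrite /good_triple (good_aroundC x z) (good_aroundC y x) (good_aroundC z y).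
by congr orb; rewrite orbC.
Qed.

Lemma badC12 x y z : bad x y z = bad y x z.
Proof. by rewrite /bad_triple h12 goodC12. Qed.

Lemma badC23 x y z : bad x y z = bad x z y.
Proof. by rewrite /bad_triple h23 goodC23. Qed.

Lemma bad_h x y z : bad x y z -> h x y z. Proof. by case/andP. Qed.

Ltac distinct :=
  repeat match goal with
    | H : is_true (bad _ _ _) |- _ => apply bad_h in H
    end;
  repeat match goal with
    | H : is_true (h _ _ _) |- _ => case: (h_neq H) => ? ? ?; clear H
    | H : is_true (heavy _ _) |- _ => apply heavy_neq in H
    end;
  repeat match goal with
    | H : is_true (_ \notin [:: _]) |- _ => rewrite !inE ?negb_or -?andbA in H
    | H : is_true (_ \notin [:: _, _ & _]) |- _ => rewrite !inE ?negb_or -?andbA in H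
    end;
  repeat match goal with
    | H : is_true (_ && _) |- _ => case/andP: H => ? ?
    end;
  rewrite /= ?inE ?negb_or; repeat (apply/andP; split);
  solve [assumption | done | rewrite eq_sym; assumption].

Ltac hedge :=
  solve [assumption | by rewrite h12 | by rewrite h23 | by rewrite h12 h23
        | by rewrite h23 h12 | by rewrite h12 h23 h12].

(** The seven vertices are listed along the path, so the third and fifth arguments are the two
    vertices shared by consecutive edges. *)
Ltac lpath a b c d e f g :=
  apply: (@h_free a b c d e f g); [hedge | hedge | hedge | distinct].

(** Each heavy pair extends to an edge by a fresh third vertex. The last choice has to avoid six
    vertices, which is where the threshold of seven common neighbours is reached. *)
Lemma heavy_path_free a b c d :
  heavy a b -> heavy b c -> heavy c d -> uniq [:: a; b; c; d] -> False.
Proof.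
move=> ab bc cd; rewrite /= !inE !negb_or => abcd.
have [x hx xS] := @heavy_ext [:: a; b; c; d] _ _ ab isT.
have [y hy yS] := @heavy_ext [:: a; b; c; d; x] _ _ bc isT.
have [z hz zS] := @heavy_ext [:: a; b; c; d; x; y] _ _ cd isT.
lpath x a b y c d z.
Qed.

Lemma codeg_gt1 w x y : 1 < codeg x y -> exists2 z, h x y z & z != w.
Proof.
case/card_gt1P => z [t]; rewrite !inE => -[xyz xyt zt].
have [zw|] := eqVneq z w; last by exists z.
by exists t; rewrite // -zw eq_sym.
Qed.

Lemma light_card x y : ~~ heavy x y -> #|[set z | h x y z]| <= 6.
Proof. by rewrite -leqNgt. Qed.

(* [U] is what would survive the removal of the vertices in few bad edges. *)
Section Core.
Variable U : {set V}.
Hypothesis U_deg : forall v, v \in U ->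
  100 < #|[set p : V * V | [&& p.1 \in U, p.2 \in U & bad v p.1 p.2]]|.

(** Each light [s] lies in at most six edges with [v], so at most 50 pairs [(s, q)] or [(x, y)] with
    [y] in [Y] are excluded, hence 100 in both orders. One of the more than 100 bad pairs at [v]
    remains. *)
Lemma core_ext (S Y : seq V) (v x : V) :
  v \in U -> {in S, forall s, ~~ heavy v s} -> 6 * size S + size Y <= 50 ->
  (exists p q, [/\ bad v p q, p \in U, q \in U, p \notin x :: S & q \notin x :: S])
  \/ (exists q, [/\ bad v x q, q \in U, q \notin S & q \notin Y]).
Proof.
move=> vU lightS szSY.
set P := [set p : V * V | [&& p.1 \in U, p.2 \in U & bad v p.1 p.2]].
pose nbs s := enum [set q | h v s q].
have sz_nbs : sumn [seq size (nbs s) | s <- S] <= 6 * size S.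
  elim: S lightS {szSY} => //= s S IH lightS.
  rewrite mulnS leq_add //; last by apply: IH => t tS; apply: lightS; rewrite inE tS orbT.
  by rewrite -cardE light_card // lightS ?mem_head.
pose L := [seq (s, q) | s <- S, q <- nbs s] ++ [seq (x, q) | q <- Y].
have szL : size L <= 50.
  by apply: leq_trans szSY; rewrite size_cat size_map leq_add2r size_allpairs_dep.
have /subsetPn[[p q]] : ~~ (P \subset L ++ [seq (p.2, p.1) | p <- L]).
  apply/negP => /subset_leq_card leP; have := leq_trans (U_deg vU) leP.
  move=> /leq_trans/(_ (card_size _)); rewrite size_cat size_map.
  by rewrite ltnNge (leq_trans (leq_add szL szL)).
rewrite inE /= => /and3P[pU qU vpq]; rewrite mem_cat negb_or => /andP[pqL qpL].
have {qpL} : (q, p) \notin L by apply: contra qpL => /(map_f (fun p => (p.2, p.1))).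
have hpq := bad_h vpq.
have inS s t : h v s t -> (s, t) \notin L -> s \notin S.
  move=> hst; apply: contra => sS; rewrite mem_cat; apply/orP; left.
  by apply/allpairsPdep; exists s, t; split; rewrite // mem_enum inE.
have inY t : (x, t) \notin L -> t \notin Y.
  by apply: contra => tY; rewrite mem_cat map_f ?orbT.
move=> qpL; have pS := inS _ _ hpq pqL.
have qS : q \notin S by apply: inS qpL; rewrite h23.
have [px|pnx] := eqVneq p x; first by subst p; right; exists q; split=> //; apply: inY.
have [qx|qnx] := eqVneq q x.
  by subst q; right; exists p; split=> //; [rewrite badC23 | apply: inY].
by left; exists p, q; rewrite !inE !negb_or pnx qnx.
Qed.

Lemma core_avoid (S : seq V) (v : V) :
  v \in U -> size S <= 5 ->
  (exists p q, [/\ h v p q, p \notin S & q \notin S]) \/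
  (exists2 s, s \in S & heavy v s) /\ (forall u, heavy v u -> u \in S).
Proof.
move=> vU szS; case: (boolP (has (heavy v) S)) => [/hasP hasS|/hasPn lightS].
  case: (boolP [exists u, heavy v u && (u \notin S)]) => [/existsP[u /andP[vu uS]]|].
    have [q huq qS] := @heavy_ext S _ _ vu (leqW szS).
    by left; exists u, q.
  rewrite negb_exists => /forallP noU; right; split=> // u vu.
  by move: (noU u); rewrite vu negbK.
(* With [x := v] the second alternative is an edge with a repeated vertex. *)
left; have [|[p [q [/bad_h vpq _ _]]]|[q [/bad_h vpq _ qS _]]] := @core_ext S [::] v v vU lightS.
- by rewrite /=; lia.
- by rewrite !inE !negb_or => /andP[_ ?] /andP[_ ?]; exists p, q.
- by case: (h_neq vpq); rewrite eqxx.
Qed.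

(** Every loose path found here uses the edge [y z w], which misses the centre [x] of the star. The
    degree condition in [U] provides a further edge at [y], and heavy pairs provide fresh end
    vertices. *)
Lemma core_star x y z w :
  y \in U -> h y z w -> w != x -> heavy y x -> heavy z x ->
  (forall u, heavy y u -> u = x) -> (forall u, heavy z u -> u = x) -> False.
Proof.
move=> yU yzw wx yx zx Ny Nz.
have zNx := heavy_neq zx.
have yz : ~~ heavy y z by apply: contraNN zNx => /Ny ->.
have yw : ~~ heavy y w by apply: contraNN wx => /Ny ->.
(* Avoiding [Y] ensures that no edge on [y] and [v] has [z] or [w] as its third vertex. *)
pose Y := enum [set v | h y z v] ++ enum [set v | h y w v].
have [||[p [q [/bad_h ypq _ _ pS qS]]]|[v [yxv vU vS]]] := @core_ext [:: z; w] Y y x yU.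
- by move=> s; rewrite !inE => /orP[] /eqP->.
- by rewrite size_cat -!cardE /=; move: (light_card yz) (light_card yw); lia.
- have [v zxv vS] := @heavy_ext [:: p; q; y; w; z] _ _ zx isT.
  lpath p q y w z x v.
have hyxv := bad_h yxv.
rewrite mem_cat !mem_enum !inE negb_or => /andP[yzv ywv].
(* If [x v] is heavy, then [x] dominates both [y] and [v], so the edge [y x v] can be bad only if
   [y v] lies in a second edge. *)
have [xv|xv] := boolP (heavy x v).
  have Nv u : heavy v u -> u = x.
    move=> vu; apply/eqP/negPn/negP => ux.
    have uy : u != y.
      apply/eqP => uy; move: vu; rewrite uy heavyC => /Ny vx.
      by case: (h_neq hyxv) => _ _; rewrite vx eqxx.
    apply: (@heavy_path_free u v x y); rewrite 1?heavyC //.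
    distinct.
  have /(codeg_gt1 x)[t yvt tx] : 1 < codeg y v.
    rewrite ltnNge; apply/negP => yv1; move: yxv; rewrite badC12 => /andP[_ /negP[]].
    rewrite /good_triple /good_around /heavy_arc -!(heavyC v x) -!(heavyC y x) yx heavyC xv yv1.
    apply/orP; left; apply/orP; left; apply/and3P; split=> //; apply/forallP => u; apply/implyP.
      by rewrite heavyC => /Ny->.
    by rewrite heavyC => /Nv->.
  have tz : t != z by apply: contraNneq yzv => <-; rewrite h23.
  have tw : t != w by apply: contraNneq ywv => <-; rewrite h23.
  have [s zxs sS] := @heavy_ext [:: v; t; y; w; z] _ _ zx isT.
  lpath v t y w z x s.
have [[p [q [vpq pS qS]]]|[[s sS vs] _]] := @core_avoid [:: x; y; z; w] v vU isT.
  lpath p q v x y z w.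
move: sS; rewrite !inE => /or4P[] /eqP es; subst s.
- by rewrite heavyC vs in xv.
- by rewrite heavyC in vs; case: (h_neq hyxv) => _ _; rewrite (Ny _ vs) eqxx.
- by rewrite heavyC in vs; case: (h_neq hyxv) => _ _; rewrite (Nz _ vs) eqxx.
have [u vwu uS] := @heavy_ext [:: x; y; z] _ _ vs isT.
have [t yxt tS] := @heavy_ext [:: u; v; w; z] _ _ yx isT.
lpath u v w z y x t.
Qed.

(** A third heavy edge would complete a heavy path, so [x] is the only heavy neighbour of [y] and of
    [z]. Badness must then come from a second edge on [y z], the situation of [core_star]. *)
Lemma core_two x y z : y \in U -> bad x y z -> heavy x y -> heavy x z -> ~~ heavy y z -> False.
Proof.
move=> yU xyz xy xz yz.
have Ny u : heavy y u -> u = x.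
  move=> yu; apply/eqP/negPn/negP => ux; have uz : u != z by apply: contraNneq yz => <-.
  apply: (@heavy_path_free u y x z); rewrite 1?heavyC // 1?heavyC //; distinct.
have Nz u : heavy z u -> u = x.
  move=> zu; apply/eqP/negPn/negP => ux.
  have uy : u != y by apply: contraNneq yz => <-; rewrite heavyC.
  apply: (@heavy_path_free u z x y); rewrite 1?heavyC // 1?heavyC //; distinct.
have /(codeg_gt1 x)[w yzw wx] : 1 < codeg y z.
  rewrite ltnNge; apply/negP => yz1; move: xyz => /andP[_ /negP[]].
  rewrite /good_triple /good_around /heavy_arc xy xz yz1.
  apply/orP; left; apply/orP; left; apply/and3P; split=> //; apply/forallP => u; apply/implyP.
    by rewrite heavyC => /Ny->.
  by rewrite heavyC => /Nz->.
by apply: (core_star yU yzw wx) => //; rewrite heavyC.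
Qed.

(** Either an edge at [w] starts a loose path with middle edge [w x y], or [w] is heavy to a vertex
    of the triangle, which gives a heavy path with three edges. *)
Lemma core_three_edge x y z w : w \in U -> w != z -> h x y w ->
  heavy x y -> heavy x z -> heavy y z -> False.
Proof.
move=> wU wz xyw xy xz yz.
have [[p [q [wpq pS qS]]]|[[s sS ws] _]] := @core_avoid [:: x; y; z] w wU isT.
  have [s yzs sS] := @heavy_ext [:: p; q; w; x; y] _ _ yz isT.
  lpath p q w x y z s.
move: sS; rewrite !inE => /or3P[] /eqP es; subst s.
- apply: (@heavy_path_free w x y z) => //; distinct.
- apply: (@heavy_path_free w y x z) => //; [by rewrite heavyC | distinct].
- apply: (@heavy_path_free w z x y) => //; [by rewrite heavyC | distinct].
Qed.

(** Some bad edge at [x] differs from [x y z]. It meets the heavy triangle in two vertices, or only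
    in [x] and then starts a loose path. *)
Lemma core_three x y z : x \in U -> heavy x y -> heavy x z -> heavy y z -> False.
Proof.
move=> xU xy xz yz.
have [//||[p [q [/bad_h xpq pU qU]]]|[w [/bad_h xyw wU _]]] := @core_ext [::] [:: z] x y xU.
- by [].
- rewrite !inE => py qy.
  have [pz|pz] := eqVneq p z.
    by subst p; apply: (@core_three_edge x z y q); rewrite // heavyC.
  have [qz|qz] := eqVneq q z.
    by subst q; apply: (@core_three_edge x z y p); rewrite // 1?h23 // heavyC.
  have [r xyr rS] := @heavy_ext [:: p; q; x; y; z] _ _ xy isT.
  have [s yzs sS] := @heavy_ext [:: p; q; x; y; r] _ _ yz isT.
  lpath p q x r y z s.
- by rewrite !inE => wz; apply: (@core_three_edge x y z w).
Qed.

(** An edge [b d e] away from [a] and [c] confines the heavy neighbours of [a] and of [c] to [d] and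
    [e]. Two different ones would give a loose path, so [a] and [c] hang on a common centre and
    [core_star] applies. *)
Lemma core_zero a b c : a \in U -> b \in U -> c \in U -> h a b c ->
  ~~ heavy a b -> ~~ heavy a c -> ~~ heavy b c -> False.
Proof.
move=> aU bU cU abc ab ac bc.
have [[d [e [bde dS eS]]]|[[s]]] := @core_avoid [:: a; c] b bU isT; last first.
  by rewrite !inE => /orP[] /eqP->; rewrite ?(negPf bc) // heavyC (negPf ab).
have nbr a' c' : a' \in U -> h a' b c' -> ~~ heavy a' b -> ~~ heavy a' c' ->
    d \notin [:: a'; c'] -> e \notin [:: a'; c'] ->
    (exists s, heavy a' s) /\ (forall u, heavy a' u -> u \in [:: d; e]).
  move=> a'U abc' ab' ac' dS' eS'.
  have [[p [q [apq pS qS]]]|[[s sS as_] Na]] := @core_avoid [:: b; c'; d; e] a' a'U isT.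
    by exfalso; lpath p q a' c' b d e.
  split; first by exists s.
  move=> u au; move: (Na _ au); rewrite !inE => /or4P[] /eqP eu; subst u.
  - by rewrite au in ab'.
  - by rewrite au in ac'.
  - by rewrite eqxx.
  - by rewrite eqxx orbT.
have [[s as_] Na] : (exists s, heavy a s) /\ (forall u, heavy a u -> u \in [:: d; e]).
  by apply: (nbr a c).
have [[t ct] Nc] : (exists s, heavy c s) /\ (forall u, heavy c u -> u \in [:: d; e]).
  apply: (nbr c a) => //; try (by rewrite heavyC); first by hedge.
  - by move: dS; rewrite !inE orbC.
  - by move: eS; rewrite !inE orbC.
have same u v : heavy a u -> heavy c v -> u = v.
  move=> au cv; apply/eqP/negPn/negP => uv.
  have buv : h b u v.
    move: (Na _ au) (Nc _ cv) uv; rewrite !inE => /orP[] /eqP-> /orP[] /eqP->; rewrite ?eqxx //.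
    by move=> _; hedge.
  have [x aux xS] := @heavy_ext [:: a; b; c; u; v] _ _ au isT.
  have [y cvy yS] := @heavy_ext [:: a; b; c; u; v; x] _ _ cv isT.
  have deS t' : t' \in [:: d; e] -> t' \notin [:: a; c].
    by rewrite [t' \in _]inE [t' \in _]inE => /orP[] /eqP->.
  have acu := deS _ (Na _ au); have acv := deS _ (Nc _ cv).
  lpath x a u b v c y.
apply: (@core_star s a c b aU) => //; first by hedge.
- by move: (Na _ as_) (h_neq bde); rewrite !inE => /orP[] /eqP-> [? ? ?].
- by rewrite (same _ _ as_ ct).
- by move=> u au; rewrite (same _ _ au ct) (same _ _ as_ ct).
- by move=> u cu; rewrite (same _ _ as_ cu).
Qed.

Lemma core_one_isolated a b c d e : h a b c -> h a d e -> d \notin [:: b; c] ->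
  e \notin [:: b; c] -> heavy b c -> ~~ heavy a b ->
  forall u, heavy b u -> u = c.
Proof.
move=> abc ade dS eS bc ab u bu; apply/eqP/negPn/negP => uc.
have ua : u != a by apply: contraNneq ab => <-; rewrite heavyC.
have aux d' e' : h a d' e' -> d' \notin [:: b; c] -> e' \notin [:: b; c] -> u = d' -> False.
  move=> ade' dS' eS' ud; subst d'.
  have [x bux xS] := @heavy_ext [:: e'; a; u; b; c] _ _ bu isT.
  have [y bcy yS] := @heavy_ext [:: e'; a; u; x; b] _ _ bc isT.
  lpath e' a u x b c y.
have [ud|ud] := eqVneq u d; first exact: (aux d e).
have [ue|ue] := eqVneq u e; first by apply: (aux e d); rewrite // h23.
have [x bux xS] := @heavy_ext [:: a; b; c; d; e] _ _ bu isT.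
lpath u x b c a d e.
Qed.

(** The edges [a b c] and [a b w] force [a] and [w] to be each other's only heavy neighbours. The
    degree of [a] then yields an edge [a w y]; either [y] starts a loose path, or it is heavy to one
    of [a], [w], [b], [c], whose only heavy neighbours are already known. *)
Lemma core_one_codegree a b c w : a \in U -> h a b w -> w != c -> h a b c ->
  heavy b c -> ~~ heavy a b -> ~~ heavy a c ->
  (forall u, heavy b u -> u = c) -> (forall u, heavy c u -> u = b) -> False.
Proof.
move=> aU abw wc abc bc ab ac Nb Nc.
have noavoid p q : h a p q -> p \notin [:: b; c; w] -> q \notin [:: b; c; w] -> False.
  move=> apq pS qS.
  have [x bcx xS] := @heavy_ext [:: p; q; a; w] _ _ bc isT.
  lpath p q a w b c x.
have [[p [q [apq pS qS]]]|[[s sS as_] Na]] := @core_avoid [:: b; c; w] a aU isT.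
  exact: noavoid apq pS qS.
have {}Na u : heavy a u -> u = w.
  move=> au; move: (Na _ au); rewrite !inE => /or3P[] /eqP eu //; subst u.
    by rewrite au in ab.
  by rewrite au in ac.
have aw : heavy a w by rewrite -(Na s).
clear s sS as_.
have Nw u : heavy w u -> u = a.
  move=> wu; apply/eqP/negPn/negP => ua.
  have ub : u != b by apply: contraNneq wc => ub; rewrite ub heavyC in wu; rewrite (Nb _ wu).
  have uc : u != c.
    by apply/eqP => uc; rewrite uc heavyC in wu; move: (Nc _ wu) (h_neq abw) => -> []; rewrite eqxx.
  have [x wux xS] := @heavy_ext [:: a; b; c] _ _ wu isT.
  have [y bcy yS] := @heavy_ext [:: u; x; w; a] _ _ bc isT.
  lpath u x w a b c y.
have [||[p [q [/bad_h apq _ _ pS qS]]]|[y [/bad_h awy yU yS _]]] := @core_ext [:: b; c] [::] a w aU.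
- by move=> s; rewrite !inE => /orP[] /eqP->.
- by [].
- by apply: (noavoid p q) => //; [move: pS | move: qS]; rewrite !inE !negb_or => /and3P[-> -> ->].
have [[p [q [ypq pS qS]]]|[[s sS ys] _]] := @core_avoid [:: a; w; b; c] y yU isT.
  lpath p q y w a b c.
have [_ _ wNy] := h_neq awy.
move: yS sS; rewrite !inE negb_or => /andP[yb yc] /or4P[] /eqP es; subst s; rewrite heavyC in ys.
- by rewrite (Na _ ys) eqxx in wNy.
- by move: (Nw _ ys) (h_neq awy) => -> []; rewrite eqxx.
- by rewrite (Nb _ ys) eqxx in yc.
- by rewrite (Nc _ ys) eqxx in yb.
Qed.

(** The vertices [b] and [c] dominate each other and both pairs at [a] have codegree at most 1, so
    the edge is good after all. *)
Lemma core_one a b c : a \in U -> bad a b c -> heavy b c -> ~~ heavy a b -> ~~ heavy a c -> False.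
Proof.
move=> aU abc_bad bc ab ac; have abc := bad_h abc_bad.
have [[d [e [ade dS eS]]]|[[s]]] := @core_avoid [:: b; c] a aU isT; last first.
  by rewrite !inE => /orP[] /eqP->; rewrite ?(negPf ab) ?(negPf ac).
have Nb : forall u, heavy b u -> u = c by apply: (core_one_isolated abc ade).
have Nc : forall u, heavy c u -> u = b.
  apply: (@core_one_isolated a c b d e); rewrite // 1?h23 // 1?heavyC //.
  - by move: dS; rewrite !inE orbC.
  - by move: eS; rewrite !inE orbC.
have two b' c' : h a b' c' -> heavy b' c' -> ~~ heavy a b' -> ~~ heavy a c' ->
    (forall u, heavy b' u -> u = c') -> (forall u, heavy c' u -> u = b') -> codeg a b' <= 1.
  move=> abc' bc' ab' ac' Nb' Nc'; rewrite leqNgt; apply/negP => /(codeg_gt1 c')[w abw wc].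
  by apply: (core_one_codegree aU abw wc abc').
case/andP: abc_bad => _ /negP[]; rewrite /good_triple; apply/orP; left; apply/orP; right.
apply/and4P; split.
- by rewrite /heavy_arc bc; apply/forallP => u; apply/implyP; rewrite heavyC => /Nc->.
- by rewrite /heavy_arc heavyC bc; apply/forallP => u; apply/implyP; rewrite heavyC => /Nb->.
- exact: (two b c).
- by apply: (two c b); rewrite // 1?h23 // heavyC.
Qed.

Lemma core_empty : U = set0.
Proof.
apply/eqP/set0Pn => -[a aU].
have /card_gt0P[[b c]] := leq_ltn_trans (leq0n _) (U_deg aU).
rewrite inE /= => /and3P[bU cU abc].
have bac : bad b a c by rewrite badC12.
have cab : bad c a b by rewrite badC12 badC23.
(* The cases are sorted by the number of heavy pairs inside a bad edge. *)
have [ab|ab] := boolP (heavy a b); have [ac|ac] := boolP (heavy a c);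
  have [bc|bc] := boolP (heavy b c).
- exact: (core_three aU ab ac bc).
- exact: (core_two bU abc).
- by apply: (core_two aU bac); rewrite // heavyC.
- by apply: (core_one cU cab); rewrite // heavyC.
- by apply: (core_two aU cab); rewrite // heavyC.
- by apply: (core_one bU bac); rewrite // heavyC.
- exact: (core_one aU abc).
- exact: (core_zero aU bU cU (bad_h abc)).
Qed.

End Core.

End LoosePathFree.

(** * Counting the bad triples of one colour *)

Lemma card_exists_le (I T : finType) (P : I -> pred T) :
  #|[set x | [exists i, P i x]]| <= \sum_i #|[set x | P i x]|.
Proof.
have -> : [set x | [exists i, P i x]] = \bigcup_i [set x | P i x].
  apply/setP => x; rewrite inE; apply/existsP/bigcupP => -[i]; first by exists i; rewrite ?inE.
  by move=> _; rewrite inE; exists i.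
apply: (big_rec2 (fun A s => #|pred_of_set A| <= s)); first by rewrite cards0.
by move=> i s A _ leA; rewrite (leq_trans (leq_card_setU _ _)) // leq_add2l.
Qed.

(** Induction on [U]: removing a vertex that lies in at most [d] pairs destroys at most [d] ordered
    triples for each of its three positions. *)
Lemma peeling (V : finType) (b : V -> V -> V -> bool) (d : nat) :
  (forall x y z, b x y z = b y x z) -> (forall x y z, b x y z = b x z y) ->
  (forall U : {set V}, U != set0 -> exists2 v, v \in U &
     #|[set p : V * V | [&& p.1 \in U, p.2 \in U & b v p.1 p.2]]| <= d) ->
  #|[set t : V * V * V | b t.1.1 t.1.2 t.2]| <= 3 * d * #|V|.
Proof.
move=> b12 b23 low.
pose restr (U : {set V}) :=
  [set t : V * V * V | [&& t.1.1 \in U, t.1.2 \in U, t.2 \in U & b t.1.1 t.1.2 t.2]].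
suff restrU (U : {set V}) : #|restr U| <= 3 * d * #|U|.
  rewrite -cardsT; apply: leq_trans (restrU setT).
  by apply/subset_leq_card/subsetP => t; rewrite !inE.
have [m szU] := ubnP #|U|; elim: m U szU => // m IH U szU.
have [->|/low[v vU dv]] := eqVneq U set0.
  by rewrite (_ : restr _ = set0) ?cards0 //; apply/setP => t; rewrite !inE.
set N := [set p | _] in dv.
have cU : #|U| = #|U :\ v|.+1 by rewrite (cardsD1 v) vU.
have := IH (U :\ v); rewrite -ltnS -cU => /(_ szU) IHv.
rewrite cU mulnS addnC; have /subset_leq_card/leq_trans : restr U \subset
    restr (U :\ v) :|: ([set (v, p.1, p.2) | p in N] :|:
      ([set (p.1, v, p.2) | p in N] :|: [set (p.1, p.2, v) | p in N])).
  apply/subsetP => -[[x y] z]; rewrite inE /= => /and4P[xU yU zU bxyz].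
  have [xv|xv] := eqVneq x v.
    rewrite !inE; apply/orP; right; apply/orP; left; apply/imsetP; exists (y, z) => /=.
      by rewrite inE /= yU zU -xv.
    by rewrite xv.
  have [yv|yv] := eqVneq y v.
    rewrite !inE; apply/orP; right; apply/orP; right; apply/orP; left.
    apply/imsetP; exists (x, z) => /=.
      by rewrite inE /= xU zU -yv b12.
    by rewrite yv.
  have [zv|zv] := eqVneq z v.
    rewrite !inE; apply/orP; right; apply/orP; right; apply/orP; right.
    apply/imsetP; exists (x, y) => /=.
      by rewrite inE /= xU yU -zv b12 b23.
    by rewrite zv.
  by rewrite !inE /= xv yv zv xU yU zU bxyz.
apply; apply: leq_trans (leq_card_setU _ _) _; apply: leq_add => //.
apply: leq_trans (leq_card_setU _ _) _; rewrite (_ : 3 * d = d + (d + d)); last by lia.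
apply: leq_add; first exact: leq_trans (leq_imset_card _ _) dv.
apply: leq_trans (leq_card_setU _ _) _; apply: leq_add.
  exact: leq_trans (leq_imset_card _ _) dv.
exact: leq_trans (leq_imset_card _ _) dv.
Qed.

Section OneColour.
Variables (V : finType) (h : V -> V -> V -> bool).
Hypothesis h12 : forall x y z, h x y z = h y x z.
Hypothesis h23 : forall x y z, h x y z = h x z y.

Lemma bad_triples_le :
  (forall x y z, h x y z -> x != y) -> loose_path_free h ->
  #|[set t : V * V * V | bad_triple h t.1.1 t.1.2 t.2]| <= 300 * #|V|.
Proof.
move=> h_neq h_free; apply: (@peeling _ _ 100); [exact: badC12 | exact: badC23 |].
move=> U U0; apply/exists_inP; apply: contraNT U0 => /exists_inPn noU; apply/eqP.
by apply: (core_empty h12 h23 h_neq h_free) => v vU; rewrite ltnNge noU.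
Qed.

Lemma heavy_arc_in_le1 y : #|[set x | heavy_arc h x y]| <= 1.
Proof.
apply/card_le1_eqP => x x'; rewrite !inE => /andP[xy /forallP Nx] /andP[x'y _].
by have /implyP/(_ x'y)/eqP-> := Nx x'.
Qed.

Lemma heavy_arc_irr x : (forall x y z, h x y z -> x != y) -> ~~ heavy_arc h x x.
Proof.
by move=> h_neq; apply/negP => /andP[/(heavy_neq h12 h23 h_neq)]; rewrite eqxx.
Qed.

(** Each form of good triple either has an arc between two given vertices of the triple or gives
    them codegree at most 1. *)
Lemma good_third_le1 x y : ~~ heavy_arc h x y -> ~~ heavy_arc h y x ->
  #|[set z | h x y z && good_triple h x y z]| <= 1.
Proof.
move=> /negPf xy /negPf yx; set G := [set z | _].
have [->|/set0Pn[z0]] := eqVneq G set0.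
  by rewrite cards0.
rewrite inE => /andP[_ gz0]; suff le1 : codegree h x y <= 1.
  apply: leq_trans le1; apply/subset_leq_card/subsetP => z; rewrite !inE.
  by case/andP.
have cyx := codegC h12 y x.
by case/or3P: gz0 => /orP[/and3P[]|/and4P[]]; rewrite ?xy ?yx // cyx.
Qed.

End OneColour.

(** * The digraph of a colouring *)

Section Coloured.
Variables (V : finType) (k : nat) (h : 'I_k -> V -> V -> V -> bool).
Hypothesis h12 : forall i x y z, h i x y z = h i y x z.
Hypothesis h23 : forall i x y z, h i x y z = h i x z y.
Hypothesis h_neq12 : forall i x y z, h i x y z -> x != y.
Hypothesis h_free : forall i, loose_path_free (h i).
Hypothesis h_total : forall x y z, uniq [:: x; y; z] -> exists i, h i x y z.

Definition dominates x y := [exists i, heavy_arc (h i) x y].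
Definition strictly_dominates x y := dominates x y && ~~ dominates y x.
Definition bad_in_colour x y z := [exists i, bad_triple (h i) x y z].
Definition unrelated x y := [&& x != y, ~~ dominates x y & ~~ dominates y x].

Lemma dominates_irr x : ~~ dominates x x.
Proof. by apply/existsPn => i; exact: (heavy_arc_irr (h12 i) (h23 i) x (h_neq12 (i := i))). Qed.

Lemma dominators_le y : #|[set x | dominates x y]| <= k.
Proof.
apply: leq_trans (card_exists_le _) _.
apply: (@leq_trans (\sum_(i < k) 1)); last by rewrite sum1_card card_ord.
by apply: leq_sum => i _; apply: heavy_arc_in_le1.
Qed.

Lemma bad_in_colour_le :
  #|[set t : V * V * V | bad_in_colour t.1.1 t.1.2 t.2]| <= 300 * #|V| * k.
Proof.
apply: leq_trans (card_exists_le (fun i t => bad_triple (h i) t.1.1 t.1.2 t.2)) _.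
apply: (@leq_trans (\sum_(i < k) 300 * #|V|)); last by rewrite sum_nat_const card_ord mulnC.
apply: leq_sum => i _; apply: bad_triples_le;
  [exact: h12 | exact: h23 | exact: h_neq12 | exact: h_free].
Qed.

Lemma unrelated_bad x y : unrelated x y ->
  #|V| - 2 - k <= #|[set z | bad_in_colour x y z]|.
Proof.
case/and3P => xy /existsPn Nxy /existsPn Nyx.
pose G := [set z | [exists i, h i x y z && good_triple (h i) x y z]].
have leG : #|G| <= k.
  apply: leq_trans (card_exists_le _) _.
  apply: (@leq_trans (\sum_(i < k) 1)); last by rewrite sum1_card card_ord.
  by apply: leq_sum => i _; apply: (good_third_le1 (h12 i)).
have : #|[set: V]| <= #|[set x; y] :|: ([set z | bad_in_colour x y z] :|: G)|.
  apply/subset_leq_card/subsetP => z _; rewrite !inE.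
  have [//|zx] := eqVneq z x; have [//|zy] := eqVneq z y.
  have [|i xyz] := @h_total x y z; first by rewrite /= !inE negb_or xy eq_sym zx eq_sym zy.
  have [gi|ngi] := boolP (good_triple (h i) x y z).
    by apply/orP; right; apply/orP; right; apply/existsP; exists i; rewrite xyz.
  by apply/orP; right; apply/orP; left; apply/existsP; exists i; rewrite /bad_triple xyz.
have := leq_card_setU [set x; y] ([set z | bad_in_colour x y z] :|: G).
have := leq_card_setU [set z | bad_in_colour x y z] G.
rewrite cardsT cards2 xy => -[le1 _] [le2 _] le3.
rewrite -subnDA leq_subLR; apply: leq_trans le3 _; apply: leq_trans le2 _.
by rewrite -addnA leq_add2l addnC; apply: leq_trans le1 _; rewrite leq_add2l.
Qed.

(** Double counting of the bad triples whose first two vertices are unrelated. *)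
Lemma unrelated_le :
  (#|V| - 2 - k) * #|[set p : V * V | unrelated p.1 p.2]| <= 300 * #|V| * k.
Proof.
apply: leq_trans bad_in_colour_le; rewrite -!sum1dep_card.
rewrite -(pair_big_dep xpredT (fun p z => bad_in_colour p.1 p.2 z) (fun _ _ => 1)) /=.
rewrite big_distrr big_mkcond /=; apply: leq_sum => -[x y] _ /=.
by case: ifP => // /unrelated_bad; rewrite sum1dep_card muln1.
Qed.

(** A good triple contains a vertex dominating the two others or a 2-cycle; a strict directed
    triangle contains neither. Hence the triple is bad in any colour it has. *)
Lemma bad_of_cyclic x y z : strictly_dominates x y -> strictly_dominates y z ->
  strictly_dominates z x -> bad_in_colour x y z.
Proof.
move=> /andP[xy /existsPn yx] /andP[yz /existsPn zy] /andP[zx /existsPn xz].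
have neq u v : dominates u v -> u != v by apply: contraTneq => ->; apply: dominates_irr.
have [|i xyz] := @h_total x y z.
  by rewrite /= !inE negb_or (neq _ _ xy) (neq _ _ yz) (eq_sym x) (neq _ _ zx).
apply/existsP; exists i; rewrite /bad_triple xyz /good_triple /good_around.
by rewrite (negPf (yx i)) (negPf (zy i)) (negPf (xz i)) !andbF.
Qed.

End Coloured.

Import Order.TTheory GRing.Theory Num.Theory.
Local Open Scope ring_scope.

(** * Sampling *)

Section Sampling.
Variables (R : realFieldType) (V : finType) (m : nat).
Local Notation sample := {ffun 'I_m -> V}.
Local Notation n := (#|V|%:R : R).
Local Notation N := (#|{ffun 'I_m -> V}|%:R : R).

Definition update (g : sample) (b : 'I_m) (y : V) : sample :=
  [ffun a => if a == b then y else g a].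

Lemma update_same g b y : update g b y b = y.
Proof. by rewrite ffunE eqxx. Qed.

Lemma update_other g b y a : a != b -> update g b y a = g a.
Proof. by rewrite ffunE => /negPf->. Qed.

(** Redrawing coordinate [b] preserves the uniform distribution: exchanging the old value with the
    new one is an involution on pairs of a sample and a vertex. *)
Lemma sum_resample (F : sample -> R) (b : 'I_m) :
  n * (\sum_g F g) = \sum_g \sum_y F (update g b y).
Proof.
pose swap (p : sample * V) := (update p.1 b p.2, p.1 b).
have swapK : involutive swap.
  case=> g y; rewrite /swap /= update_same; congr pair; apply/ffunP => a.
  by rewrite !ffunE; case: eqP => // ->.
rewrite pair_big /= (reindex_inj (inv_inj swapK)) /=.
transitivity (\sum_(p : sample * V) F p.1); last first.
  by apply: eq_bigr => p _; rewrite -[in LHS](swapK p).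
rewrite -(pair_big xpredT xpredT (fun g _ => F g)) /= mulr_sumr.
by apply: eq_bigr => g _; rewrite sumr_const mulr_natl.
Qed.

Lemma sum_ord_const (c : R) : \sum_(a < m) c = m%:R * c.
Proof. by rewrite sumr_const card_ord mulr_natl. Qed.

Lemma sum_pair (F : V -> V -> R) (a b : 'I_m) : a != b ->
  n ^+ 2 * (\sum_(g : sample) F (g a) (g b)) = N * \sum_x \sum_y F x y.
Proof.
move=> ab; rewrite expr2 -mulrA (sum_resample _ b).
under eq_bigr do under eq_bigr do rewrite update_same update_other //.
rewrite (sum_resample (fun g => \sum_y F (g a) y) a) /=.
under eq_bigr do under eq_bigr do rewrite update_same.
by rewrite sumr_const mulr_natl.
Qed.

Lemma sum_triple (F : V -> V -> V -> R) (a b c : 'I_m) : uniq [:: a; b; c] ->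
  n ^+ 3 * (\sum_(g : sample) F (g a) (g b) (g c)) = N * \sum_x \sum_y \sum_z F x y z.
Proof.
rewrite /= !inE negb_or andbT => /andP[/andP[ab ac] bc].
rewrite exprSr -mulrA (sum_resample _ c).
under [in LHS]eq_bigr do under eq_bigr do rewrite update_same !update_other //.
exact: (sum_pair (fun x y => \sum_z F x y z) ab).
Qed.

Lemma sum_count2 (Q : rel V) :
  \sum_x \sum_y (Q x y)%:R = #|[set p : V * V | Q p.1 p.2]|%:R :> R.
Proof.
rewrite pair_big /= -sum1dep_card natr_sum [RHS]big_mkcond /=.
by apply: eq_bigr => p _; case: (Q _ _).
Qed.

Lemma sum_count3 (T : V -> V -> V -> bool) :
  \sum_x \sum_y \sum_z (T x y z)%:R =
  #|[set t : V * V * V | T t.1.1 t.1.2 t.2]|%:R :> R.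
Proof.
rewrite pair_big /= pair_big /= -sum1dep_card natr_sum [RHS]big_mkcond /=.
by apply: eq_bigr => p _; case: (T _ _ _).
Qed.

(** * Second moment of the sampled in-degrees *)

Section Deviation.
Variable D : rel V.
Hypothesis V_gt0 : (0 < #|V|)%N.

Definition density (y : V) : R := #|[set x | D x y]|%:R / n.

(** The excess of the sampled in-degree of [a] over [m] times its density in the whole digraph. *)
Definition deviation (g : sample) (a : 'I_m) : R :=
  \sum_b ((D (g b) (g a))%:R - density (g a)).

Let n_gt0 : 0 < n. Proof. by rewrite ltr0n. Qed.

Lemma density_itv y : 0 <= density y <= 1.
Proof.
rewrite /density divr_ge0 ?ler0n //= ler_pdivrMr // mul1r ler_nat.
exact: max_card.
Qed.

Lemma sum_centred y : \sum_x ((D x y)%:R - density y) = 0.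
Proof.
rewrite sumrB sumr_const -[X in _ - X]mulr_natr divfK ?gt_eqF // -sum1dep_card natr_sum.
rewrite [X in _ - X]big_mkcond -sumrB big1 // => x _.
by case: (D x y); rewrite subrr.
Qed.

(* For distinct [a], [b], [b'] the two centred indicators are independent. *)
Lemma sum_covariance a b b' :
  \sum_(g : sample) ((D (g b) (g a))%:R - density (g a)) *
                    ((D (g b') (g a))%:R - density (g a)) <=
  ((b == a)%:R + (b == b')%:R) * N.
Proof.
have le_card : \sum_(g : sample) ((D (g b) (g a))%:R - density (g a)) *
                    ((D (g b') (g a))%:R - density (g a)) <= N.
  rewrite -[N]mulr1 mulr_natl -sumr_const; apply: ler_sum => g _.
  move: (density_itv (g a)); set d := density _ => /andP[d0 d1].
  by case: (D _ _); case: (D _ _) => /=; nra.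
have [_|ba] := eqVneq b a.
  by apply: le_trans le_card _; rewrite ler_peMl ?ler0n // lerDl ler0n.
have [_|bb'] := eqVneq b b'; first by rewrite add0r mul1r.
rewrite add0r mul0r; set S := (\sum_g _); suff : n * S = 0.
  by move/eqP; rewrite mulf_eq0 gt_eqF //= => /eqP->.
rewrite /S (sum_resample _ b); apply: big1 => g _.
under eq_bigr do rewrite update_same !update_other 1?eq_sym //.
by rewrite -mulr_suml sum_centred mul0r.
Qed.

(** For fixed [a], the coincidences [b = a] and [b = b'] occur for [m] pairs each and contribute at
    most [N] apiece; the other covariances vanish. *)
Lemma sum_deviation2 : \sum_g \sum_a deviation g a ^+ 2 <= 2 * m%:R ^+ 2 * N.
Proof.
rewrite exchange_big /=; apply: (@le_trans _ _ (\sum_(a < m) 2 * m%:R * N)); last first.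
  by rewrite sum_ord_const; lra.
apply: ler_sum => a _.
under eq_bigr do rewrite expr2 /deviation mulr_suml.
rewrite exchange_big /=.
under eq_bigr do under eq_bigr do rewrite mulr_sumr.
apply: (@le_trans _ _ (\sum_b \sum_b' ((b == a)%:R + (b == b')%:R) * N)).
  by apply: ler_sum => b _; rewrite exchange_big /=; apply: ler_sum => b' _; apply: sum_covariance.
under eq_bigr do rewrite -mulr_suml big_split /= sumr_const card_ord.
rewrite -mulr_suml big_split /= ler_wpM2r ?ler0n //.
rewrite (bigD1 a) //= eqxx big1 ?addr0; last by move=> b /negPf->; rewrite mul0rn.
suff -> : \sum_(b < m) \sum_(b' < m) (b == b')%:R = m%:R :> R by rewrite mulr_natl mulr2n.
rewrite -[m in RHS]card_ord -sumr_const; apply: eq_bigr => b _.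
by rewrite (bigD1 b) //= eqxx big1 ?addr0 // => b' /negPf; rewrite eq_sym => ->.
Qed.

(** First moment method for [Psi]: the squared deviations average at most [tau / 2], and the
    expected number of forbidden pairs and triples is below 1/2. A sample with [Psi g < tau] has
    fewer than one forbidden configuration, hence none. *)
Lemma sampling (Q : rel V) (T : V -> V -> V -> bool) : (0 < m)%N ->
  (2 * (m ^ 2 * #|V| * #|[set p : V * V | Q p.1 p.2]| +
        m ^ 3 * #|[set t : V * V * V | T t.1.1 t.1.2 t.2]|) < #|V| ^ 3)%N ->
  exists g : sample, [/\ forall a b, a != b -> ~~ Q (g a) (g b),
    forall a b c, uniq [:: a; b; c] -> ~~ T (g a) (g b) (g c) &
    \sum_a deviation g a ^+ 2 < 4 * m%:R ^+ 2].
Proof.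
move=> m_gt0; set q := #|_|; set t := #|_| => small.
pose tau : R := 4 * m%:R ^+ 2.
have tau_gt0 : 0 < tau by rewrite mulr_gt0 // exprn_gt0 // ltr0n.
pose cQ (g : sample) : R := \sum_a \sum_b ((a != b) && Q (g a) (g b))%:R.
pose cT (g : sample) : R :=
  \sum_a \sum_b \sum_c (uniq [:: a; b; c] && T (g a) (g b) (g c))%:R.
pose Psi g : R := \sum_a deviation g a ^+ 2 + tau * (cQ g + cT g).
have dev_ge0 g : 0 <= \sum_a deviation g a ^+ 2 by apply: sumr_ge0 => a _; apply: sqr_ge0.
have cQ_ge0 g : 0 <= cQ g by do 2!apply: sumr_ge0 => ? _; rewrite ler0n.
have cT_ge0 g : 0 <= cT g by do 3!apply: sumr_ge0 => ? _; rewrite ler0n.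
have sumQ : n ^+ 2 * \sum_g cQ g <= m%:R ^+ 2 * (N * q%:R).
  rewrite exchange_big mulr_sumr.
  apply: (@le_trans _ _ (\sum_(a < m) \sum_(b < m) N * q%:R)); last first.
    by rewrite !sum_ord_const mulrA expr2.
  apply: ler_sum => a _; rewrite exchange_big mulr_sumr; apply: ler_sum => b _.
  have [_|ab] := eqVneq a b; first by rewrite big1 // mulr0 mulr_ge0 ?ler0n.
  by rewrite (sum_pair (fun x y => (Q x y)%:R) ab) sum_count2.
have sumT : n ^+ 3 * \sum_g cT g <= m%:R ^+ 3 * (N * t%:R).
  rewrite exchange_big mulr_sumr.
  apply: (@le_trans _ _ (\sum_(a < m) \sum_(b < m) \sum_(c < m) N * t%:R)); last first.
    by rewrite !sum_ord_const !exprS expr0 mulr1 !mulrA.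
  apply: ler_sum => a _; rewrite exchange_big mulr_sumr; apply: ler_sum => b _.
  rewrite exchange_big mulr_sumr; apply: ler_sum => c _.
  have [abc|_] := boolP (uniq [:: a; b; c]); last first.
    by rewrite big1 ?mulr0 ?mulr_ge0 ?ler0n // => g _; rewrite andFb.
  by rewrite (sum_triple (fun x y z => (T x y z)%:R) abc) sum_count3.
have [g Psi_lt] : exists g, Psi g < tau.
  apply/existsP; apply: contraT => /existsPn Psi_ge; exfalso.
  have N_gt0 : 0 < N.
    by rewrite ltr0n card_ffun card_ord expn_gt0 V_gt0.
  have : tau * N <= \sum_g Psi g.
    rewrite mulrC mulr_natl -sumr_const; apply: ler_sum => g _.
    by rewrite leNgt Psi_ge.
  rewrite big_split /= -mulr_sumr big_split /=.
  have := sum_deviation2.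
  move: small; rewrite -(ltr_nat R) !(natrM, natrD, natrX).
  set sD := \sum_g _; set sQ := \sum_g _ in sumQ *; set sT := \sum_g _ in sumT *.
  move=> small leD; apply/negP; rewrite -ltNge.
  have n3 : 0 < n ^+ 3 by rewrite exprn_gt0.
  rewrite -(ltr_pM2l n3) mulrDr.
  have leD' : n ^+ 3 * sD <= n ^+ 3 * (2 * m%:R ^+ 2 * N) by rewrite ler_pM2l.
  have leQ' : n ^+ 3 * sQ <= n * (m%:R ^+ 2 * (N * q%:R)).
    by rewrite exprS -mulrA ler_pM2l.
  have ltS : N * (2 * (m%:R ^+ 2 * n * q%:R + m%:R ^+ 3 * t%:R)) < N * n ^+ 3.
    by rewrite ltr_pM2l.
  have ltS' : tau * (n ^+ 3 * sQ + n ^+ 3 * sT) < tau * (N * n ^+ 3 / 2).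
    rewrite ltr_pM2l //; lra.
  rewrite /tau in ltS' *; lra.
have Q0 : cQ g < 1.
  rewrite -(ltr_pM2l tau_gt0) mulr1; apply: le_lt_trans Psi_lt.
  by rewrite /Psi mulrDr; have := mulr_ge0 (ltW tau_gt0) (cT_ge0 g); have := dev_ge0 g; lra.
have T0 : cT g < 1.
  rewrite -(ltr_pM2l tau_gt0) mulr1; apply: le_lt_trans Psi_lt.
  by rewrite /Psi mulrDr; have := mulr_ge0 (ltW tau_gt0) (cQ_ge0 g); have := dev_ge0 g; lra.
exists g; split.
- move=> a b ab; apply/negP => Qab; move: Q0; rewrite ltNge => /negP[].
  rewrite /cQ (bigD1 a) //= (bigD1 b) //= ab Qab -addrA lerDl.
  by apply: addr_ge0; do ?[apply: sumr_ge0 => ? _]; rewrite ler0n.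
- move=> a b c abc; apply/negP => Tabc; move: T0; rewrite ltNge => /negP[].
  rewrite /cT (bigD1 a) //= (bigD1 b) //= (bigD1 c) //= [_ && T _ _ _](_ : _ = true).
    by rewrite -!addrA lerDl; do !apply: addr_ge0; do ?[apply: sumr_ge0 => ? _]; rewrite ler0n.
  by rewrite Tabc andbT.
- apply: le_lt_trans Psi_lt; rewrite /Psi lerDl mulr_ge0 ?addr_ge0 //.
  exact: ltW.
Qed.

End Deviation.
End Sampling.

(** * The Ramsey bound *)

(** Including the diagonal makes every sample that avoids the relation injective; it raises the
    constant from 1200 to 1201. *)
Lemma few_unrelated (V : finType) (k : nat) (h : 'I_k -> V -> V -> V -> bool) :
  ((#|V| - 2 - k) * #|[set p : V * V | unrelated h p.1 p.2]| <= 300 * #|V| * k)%N ->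
  (24 <= #|V|)%N -> (3 * k <= 2 * #|V|)%N ->
  (#|[set p : V * V | (p.1 == p.2) || unrelated h p.1 p.2]| <= 1201 * #|V|)%N.
Proof.
set U := [set p | unrelated h p.1 p.2] => leU n24 k_le.
have leU' : (#|U| <= 1200 * #|V|)%N.
  rewrite -(@leq_pmul2l #|V|) ?(leq_trans _ n24) //.
  (* The two size hypotheses make [#|V| - 2 - k] at least a quarter of [#|V|]. *)
  apply: (@leq_trans (4 * ((#|V| - 2 - k) * #|U|))).
    by rewrite mulnA leq_mul2r; apply/orP; right; move: n24 k_le; lia.
  by move: leU k_le; set x := (_ * #|U|)%N; move: x #|V|; nia.
pose diag := [set (x, x) | x in [set: V]].
have : [set p : V * V | (p.1 == p.2) || unrelated h p.1 p.2] \subset diag :|: U.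
  apply/subsetP => -[x y]; rewrite !inE /= => /orP[/eqP->|->]; last by rewrite orbT.
  by apply/orP; left; apply: imset_f; rewrite inE.
move/subset_leq_card/leq_trans; apply; apply: leq_trans (leq_card_setU _ _) _.
rewrite mulSn leq_add // (leq_trans (leq_imset_card _ _)) // cardsT.
exact: leqnn.
Qed.

Lemma sampling_bound (m n q t : nat) : (2402 * m ^ 2 + 600 * m ^ 3 < n)%N ->
  (q <= 1201 * n)%N -> (t <= 300 * n ^ 2)%N ->
  (2 * (m ^ 2 * n * q + m ^ 3 * t) < n ^ 3)%N.
Proof.
move=> n_gt q_le t_le.
apply: (@leq_ltn_trans (n ^ 2 * (2402 * m ^ 2 + 600 * m ^ 3))).
  have := leq_mul (leqnn (m ^ 2 * n)) q_le; have := leq_mul (leqnn (m ^ 3)) t_le.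
  move: (m ^ 2)%N (m ^ 3)%N => a b; nia.
rewrite [X in (_ < X)%N](_ : _ = n ^ 2 * n)%N; last by rewrite -expnSr.
by rewrite ltn_pmul2l ?expn_gt0 ?(leq_ltn_trans _ n_gt).
Qed.

(** Since any two sampled vertices are related, small in-degrees force large strict out-degrees,
    which is what the sufficiency of [alpha] needs after reversal. *)
Lemma sampled_triangle (R : realType) (alpha gamma : R) (V : finType) (m : nat)
    (D : rel V) (g : {ffun 'I_m -> V}) :
  1 / 3 <= alpha -> alpha < 1 -> directed_triangle_sufficient alpha -> 0 < gamma ->
  (0 < m)%N -> 1 + 16 / gamma ^+ 2 <= gamma / 2 * m%:R ->
  (forall x, ~~ D x x) ->
  (forall x, #|[set y | D y x]|%:R <= (1 - alpha - gamma) * #|V|%:R :> R) ->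
  (0 < #|V|)%N ->
  (forall a b, a != b -> D (g a) (g b) || D (g b) (g a)) ->
  \sum_a deviation R D g a ^+ 2 < 4 * m%:R ^+ 2 ->
  exists a b c, [/\ uniq [:: a; b; c], D (g a) (g b) && ~~ D (g b) (g a),
    D (g b) (g c) && ~~ D (g c) (g b) & D (g c) (g a) && ~~ D (g a) (g c)].
Proof.
move=> alpha_ge alpha_lt alpha_dts gamma_gt0 m_gt0 m_ge Dirr D_in V_gt0 D_tot dev_lt.
have m0 : 0 < m%:R :> R by rewrite ltr0n.
(* The upper bound on an in-degree cannot be negative. *)
have gamma_le : gamma <= 1 - alpha.
  have := le_trans (ler0n R _) (D_in (g (Ordinal m_gt0))).
  by rewrite pmulr_lge0 ?ltr0n // subr_ge0.
have gamma2_le1 : gamma / 2 <= 1 by lra.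
have gm_ge0 : 0 <= gamma / 2 * m%:R by rewrite mulr_ge0 ?divr_ge0 // ltW.
(* By Chebyshev only boundedly many indices have too large an in-degree; they
   are deleted. *)
pose A := [set a | deviation R D g a < gamma / 2 * m%:R].
have cardAC : #|~: A|%:R < 16 / gamma ^+ 2.
  have gm0 : 0 < (gamma / 2 * m%:R) ^+ 2 by rewrite exprn_gt0 // mulr_gt0 // divr_gt0.
  rewrite -(ltr_pM2r gm0).
  have -> : 16 / gamma ^+ 2 * (gamma / 2 * m%:R) ^+ 2 = 4 * m%:R ^+ 2.
    by field; rewrite gt_eqF.
  apply: le_lt_trans dev_lt; rewrite mulr_natl -sumr_const.
  rewrite [X in _ <= X](bigID (mem (~: A))) /= -[X in X <= _]addr0 lerD //.
    apply: ler_sum => a; rewrite !inE -leNgt => dev_ge.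
    by rewrite ler_sqr ?nnegrE // (le_trans gm_ge0).
  by apply: sumr_ge0 => a _; apply: sqr_ge0.
have cardA : #|A|%:R = m%:R - #|~: A|%:R :> R.
  by have /(congr1 (fun i => i%:R : R)) := cardsC A; rewrite natrD card_ord => <-; rewrite addrK.
have in_deg a : a \in A -> #|[set b | D (g b) (g a)]|%:R <= (1 - alpha - gamma / 2) * m%:R :> R.
  rewrite inE /deviation sumrB sumr_const card_ord => dev_a.
  have dens : density R D (g a) *+ m <= (1 - alpha - gamma) * m%:R.
    by rewrite -[_ *+ m in X in X <= _]mulr_natr ler_pM2r // /density ler_pdivrMr ?ltr0n.
  have -> : #|[set b | D (g b) (g a)]|%:R = \sum_b (D (g b) (g a))%:R :> R.
    by rewrite -sum1dep_card natr_sum big_mkcond; apply: eq_bigr => b _; case: (D _ _).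
  by move: dev_a dens; set s := \sum_b _; lra.
pose W := {a : 'I_m | a \in A}.
have cardW : #|{: W}| = #|A| by rewrite card_sig; apply: eq_card.
(* The degree hypothesis concerns in-degrees while [D_in] yields out-degrees, so
   all arcs are reversed. *)
pose ar (a b : W) := D (g (val b)) (g (val a)) && ~~ D (g (val a)) (g (val b)).
have ar_in (a : W) : (#|A| <= indegree ar a + 1 + #|[set b | D (g b) (g (val a))]|)%N.
  have /subset_leq_card : A \subset [set val b | b : W in [set b | ar b a]] :|:
      ([set val a] :|: [set b | D (g b) (g (val a))]).
    apply/subsetP => b bA; rewrite !inE.
    have [//|ba] := eqVneq b (val a); first by rewrite orbT.
    have [//|nD] := boolP (D (g b) (g (val a))); first by rewrite !orbT.
    apply/orP; left; apply/imsetP; exists (exist _ b bA) => //; rewrite inE /ar /= nD andbT.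
    by have := D_tot _ _ ba; rewrite (negPf nD).
  move/leq_trans; apply; apply: leq_trans (leq_card_setU _ _) _.
  rewrite -addnA leq_add ?leq_imset_card //.
  by apply: leq_trans (leq_card_setU _ _) _; rewrite cards1.
have [x [y [z [xy yz zx]]]] : has_directed_triangle ar.
  apply: alpha_dts.
  - rewrite cardW -(ltr_nat R) cardA subr_gt0; apply: (lt_trans cardAC).
    have : gamma / 2 * m%:R <= m%:R by rewrite ler_piMl ?ler0n.
    by move: m_ge; lra.
  - split=> [a|a b]; first by rewrite /ar (negPf (Dirr _)).
    by rewrite /ar => /andP[-> _]; rewrite andbF.
  - move=> a; rewrite cardW; have := ar_in a; rewrite -(ler_nat R) !natrD.
    have := in_deg _ (valP a); rewrite cardA; move: cardAC.
    set c := #|~: A|%:R; set i := (indegree _ _)%:R; set d := #|_|%:R => c_lt d_le le_i.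
    (* The in-degree is at least [(alpha + gamma / 2) * m - c - 1], to be compared with
       [alpha * (m - c)]; the slack [gamma / 2 * m] covers [1 + c]. *)
    have : (1 - alpha) * c <= c by rewrite ler_piMl ?ler0n //; lra.
    by move: m_ge; lra.
have neq (a b : W) : ar a b -> val a != val b.
  by apply: contraTneq => ab; rewrite /ar ab (negPf (Dirr _)).
(* Undoing the reversal swaps [y] and [z]. *)
exists (val x), (val z), (val y); split=> //.
by rewrite /= !inE negb_or (neq _ _ xy) eq_sym (neq _ _ zx) eq_sym (neq _ _ yz).
Qed.

Lemma no_loose_path_free_colouring (R : realType) (alpha gamma : R) :
  1 / 3 <= alpha -> alpha < 1 -> directed_triangle_sufficient alpha -> 0 < gamma ->
  exists n0 : nat,
  forall (V : finType) (k : nat) (h : 'I_k -> V -> V -> V -> bool),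
  (forall i x y z, h i x y z = h i y x z) ->
  (forall i x y z, h i x y z = h i x z y) ->
  (forall i x y z, h i x y z -> x != y) ->
  (forall i, loose_path_free (h i)) ->
  (forall x y z, uniq [:: x; y; z] -> exists i, h i x y z) ->
  (n0 <= #|V|)%N -> k%:R <= (1 - alpha - gamma) * #|V|%:R -> False.
Proof.
move=> alpha_ge alpha_lt alpha_dts gamma_gt0.
(* The 1 pays for the index itself, the term [16 / gamma ^+ 2] for the deleted indices. *)
pose X := (1 + 16 / gamma ^+ 2) / (gamma / 2).
pose m := (Num.truncn X).+1.
have m_ge : 1 + 16 / gamma ^+ 2 <= gamma / 2 * m%:R.
  by rewrite [X in _ <= X]mulrC -ler_pdivrMr ?divr_gt0 //; apply/ltW/truncnS_gt.
(* The first summand serves [few_unrelated], the second [sampling_bound]. *)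
exists (24 + (2402 * m ^ 2 + 600 * m ^ 3).+1)%N.
move=> V k h h12 h23 h_neq h_free h_total V_ge k_le.
have V_gt0 : (0 < #|V|)%N by apply: leq_trans V_ge.
have n_gt0 : 0 < #|V|%:R :> R by rewrite ltr0n.
(* Here [1 / 3 <= alpha] enters: it gives [1 - alpha - gamma <= 2 / 3]. *)
have k23 : (3 * k <= 2 * #|V|)%N by rewrite -(ler_nat R) !natrM; nra.
have k_leV : (k <= #|V|)%N by move: k23; lia.
have T_le : (#|[set t : V * V * V | bad_in_colour h t.1.1 t.1.2 t.2]| <= 300 * #|V| ^ 2)%N.
  apply: leq_trans (bad_in_colour_le h12 h23 h_neq h_free) _.
  by rewrite -mulnA expnS expn1 !leq_mul.
have Q_le := few_unrelated (unrelated_le h12 h23 h_neq h_free h_total)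
  (leq_trans (leq_addr _ _) V_ge) k23.
have V_gt : (2402 * m ^ 2 + 600 * m ^ 3 < #|V|)%N by apply: leq_trans V_ge; apply: leq_addl.
have [g [gQ gT dev]] := @sampling R V m (dominates h) V_gt0
  (fun x y => (x == y) || unrelated h x y) (bad_in_colour h) isT (sampling_bound V_gt Q_le T_le).
have [|||a [b [c [abc ab bc ca]]]] := @sampled_triangle R alpha gamma V m (dominates h) g
  alpha_ge alpha_lt alpha_dts gamma_gt0 isT m_ge _ _ V_gt0 _ dev.
- by move=> x; apply: dominates_irr h_neq _.
- by move=> x; apply: le_trans k_le; rewrite ler_nat; apply: dominators_le.
- move=> a b /gQ; rewrite negb_or /unrelated => /andP[-> /=].
  by rewrite negb_and !negbK.
by have /negP[] := gT _ _ _ abc; apply: bad_of_cyclic.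
Qed.

(** * Colour classes as symmetric ternary relations *)

Section Triples.
Variables (n k : nat) (col : triple n -> 'I_k).

(** Quantifying over [triple] makes the relation symmetric and false on repeated vertices without
    any proof of distinctness as an argument. *)
Definition coloured (i : 'I_k) (x y z : 'I_n) : bool :=
  [exists t : triple n, (val t == [set x; y; z]) && (col t == i)].

Lemma colouredC12 i x y z : coloured i x y z = coloured i y x z.
Proof. by rewrite /coloured (setUC [set x]). Qed.

Lemma colouredC23 i x y z : coloured i x y z = coloured i x z y.
Proof. by rewrite /coloured -!setUA (setUC [set y]). Qed.

Lemma coloured_neq i x y z : coloured i x y z -> x != y.
Proof.
case/existsP => t /andP[/eqP tE _]; apply/eqP => xy.
have := valP t; rewrite tE xy setUid cards2; by case: (y != z).
Qed.

Lemma coloured_total x y z : uniq [:: x; y; z] -> exists i, coloured i x y z.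
Proof.
rewrite /= !inE negb_or andbT => /andP[/andP[xy xz] yz].
have xyz3 : #|[set x; y; z]| == 3%N.
  by rewrite -setUA cardsU1 cards2 !inE negb_or xy xz yz.
pose t : triple n := exist (fun A : {set 'I_n} => #|A| == 3%N) _ xyz3.
by exists (col t); apply/existsP; exists t; rewrite /= !eqxx.
Qed.

Lemma coloured_mono_copy i a b c d e f g :
  coloured i a b c -> coloured i c d e -> coloured i e f g ->
  uniq [:: a; b; c; d; e; f; g] -> has_mono_copy loose_path col.
Proof.
move=> abc cde efg uniq7.
pose F (j : 'I_7) := nth a [:: a; b; c; d; e; f; g] j.
exists F, i; split.
  by move=> j l /eqP; rewrite nth_uniq // => /eqP/val_inj.
have col_of x y z (t : triple n) : coloured i x y z -> val t = [set x; y; z] -> col t = i.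
  case/existsP => s /andP[/eqP sE /eqP <-] tE; congr col; apply: val_inj.
  by rewrite sE tE.
move=> t /imsetP[A AE tE]; move: AE tE; rewrite !inE => /orP[/orP[]|] /eqP-> /=;
  rewrite !imsetU !imset_set1 => tE.
- exact: col_of abc tE.
- exact: col_of cde tE.
- exact: col_of efg tE.
Qed.

End Triples.

(** * Choice of the constants and the upper bound *)

Theorem theorem3 (R : realType) (alpha eps : R)
    (alpha_ge : 1 / 3%:R <= alpha) (alpha_lt : alpha < 2%:R / 5%:R)
    (alpha_dts : directed_triangle_sufficient alpha) (eps_gt0 : 0 < eps) :
  exists k0 : nat, forall k : nat, (k0 <= k)%N ->
    exists r : nat, is_ramsey_number loose_path k r /\
      r%:R < (1 + eps) / (1 - alpha) * k%:R.
Proof.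
(* [c] is the midpoint of [(1 - alpha) / (1 + eps)] and [1 - alpha]: below the latter it leaves a
   positive [gamma], above the former it leaves a positive [d]. *)
pose c := (1 - alpha) * (2 + eps) / (2 * (1 + eps)).
pose gamma := 1 - alpha - c.
have e1 : 0 < 2 * (1 + eps) by lra.
have a1 : 0 < 1 - alpha by lra.
have c_gt0 : 0 < c by rewrite /c divr_gt0 // mulr_gt0 //; lra.
have gammaE : gamma = (1 - alpha) * eps / (2 * (1 + eps)).
  by rewrite /gamma /c; field; lra.
have gamma_gt0 : 0 < gamma by rewrite gammaE divr_gt0 // mulr_gt0.
have alpha_lt1 : alpha < 1 by lra.
have [n0 n0P] := no_loose_path_free_colouring alpha_ge alpha_lt1 alpha_dts gamma_gt0.
pose d := (1 + eps) / (1 - alpha) - c^-1.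
have d_gt0 : 0 < d.
  have -> : d = eps * (1 + eps) / ((1 - alpha) * (2 + eps)).
    by rewrite /d /c; field; do ?[apply/andP; split]; lra.
  by rewrite divr_gt0 // mulr_gt0 //; lra.
(* The second bound gives [d * k >= 2], more than the error of at most 1 from rounding [k / c] up to
   [n]. *)
exists (maxn n0 (Num.truncn (2 / d)).+1) => k; rewrite geq_max => /andP[n0k dk].
pose n := (Num.truncn (k%:R / c)).+1.
have kc_ge0 : 0 <= k%:R / c by rewrite divr_ge0 // ltW.
have /andP[n_le n_gt] : n%:R - 1 <= k%:R / c < n%:R.
  by have := truncn_itv kc_ge0; rewrite /n -natr1 addrK.
have k_le : k%:R <= c * n%:R by rewrite mulrC -ler_pdivrMr // ltW.
have arrow_n : ramsey_arrow loose_path k n.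
  move=> col; apply: contrapT => no_copy.
  apply: (n0P 'I_n k (coloured col)).
  - exact: colouredC12.
  - exact: colouredC23.
  - exact: coloured_neq.
  - move=> i a b c' x e f g abc cde efg u.
    by apply: no_copy; apply: coloured_mono_copy abc cde efg u.
  - exact: coloured_total.
  - rewrite card_ord; apply: leq_trans n0k _; rewrite -(ler_nat R); apply: le_trans k_le _.
    have : c <= 1 by rewrite /gamma in gamma_gt0; lra.
    by move=> c1; rewrite -[X in _ <= X]mul1r ler_wpM2r.
  - by rewrite card_ord /gamma opprB addrC subrK.
(* The Ramsey number is the least [r] with the arrow property, which [n] shows to exist. *)
pose P r := `[< ramsey_arrow loose_path k r >].
have exP : exists r, P r by exists n; apply/asboolP.
case: (ex_minnP exP) => r /asboolP r_arrow r_min.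
have r_le m : ramsey_arrow loose_path k m -> (r <= m)%N by move=> m_arrow; apply/r_min/asboolP.
exists r; split; first by split.
apply: (@le_lt_trans _ _ n%:R); first by rewrite ler_nat; apply: r_le.
have dk' : 2 <= d * k%:R.
  rewrite mulrC -ler_pdivrMr // ltW // (lt_le_trans (truncnS_gt _)) // ler_nat.
  exact: dk.
have -> : (1 + eps) / (1 - alpha) * k%:R = d * k%:R + k%:R / c.
  by rewrite /d mulrBl (mulrC k%:R) subrK.
lra.
Qed.
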